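(* With respect to the framed elementary extensions $\hat M_1,\hat M_2,\hat M_3,\hat M_w$: every based matrix is obtained from a primitive based matrix by elementary extensions, and two homologous primitive based matrices are isomorphic up to a single application of $\hat M_w$ (that is, either they are isomorphic, or one of them is isomorphic to a matrix obtained from the other by one move $\hat M_w$).
   Context: Fix an abelian group $H$. A based matrix is a triple $(G,s,b)$ with $G$ a finite set, $s\in G$ and $b\colon G\times G\to H$ skew-symmetric. An element $g\in G\setminus\{s\}$ is annihilating if $b(g,h)=0$ for all $h\in G$, and core if $b(g,h)=b(s,h)$ for all $h\in G$; elements $g_1,g_2\in G\setminus\{s\}$ are complementary if $b(g_1,h)+b(g_2,h)=b(s,h)$ for all $h\in G$. Framed elementary extensions: - $\hat M_1$ changes $(G,s,b)$ into $(G\sqcup\{g_1,g_2\},s,b_1)$ where $b_1$ is skew-symmetric, extends $b$, and $g_1,g_2$ are annihilating; - $\hat M_2$ changes $(G,s,b)$ into $(G\sqcup\{g_1,g_2\},s,b_2)$ where $b_2$ is skew-symmetric, extends $b$, and $g_1,g_2$ are core; - $\hat M_3$ changes $(G,s,b)$ into $(G\sqcup\{g_1,g_2\},s,b_3)$ where $b_3$ is any skew-symmetric map extending $b$ in which $g_1,g_2$ are complementary; - $\hat M_w$ changes $(G,s,b)$ into $(G,s,b')$ by changing one annihilating element $g$ into a core element ($b'$ is skew-symmetric, agrees with $b$ on pairs not involving $g$, and $g$ is core for $b'$). Two based matrices $(G,s,b),(G',s',b')$ are isomorphic if there is a bijection $G\to G'$ sending $s$ to $s'$ and transforming $b$ into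 $b'$. Two based matrices are homologous if they are related, up to isomorphism, by a finite sequence of the moves $\hat M_1,\hat M_2,\hat M_3,\hat M_w$ and their inverses. A based matrix is primitive if it cannot be obtained from another based matrix by the extensions $\hat M_1,\hat M_2,\hat M_3$, even after applying moves $\hat M_w^{\pm1}$ to it (i.e. no $\hat M_i^{-1}$, $i=1,2,3$, can be applied to it, nor to any matrix obtained from it by moves $\hat M_w^{\pm1}$). *)

(* Defs.v *)
From mathcomp Require Import all_boot all_algebra.
From Stdlib Require Export Relation_Definitions Relation_Operators.

Set Implicit Arguments.
Unset Strict Implicit.
Unset Printing Implicit Defensive.

Import GRing.Theory.
Local Open Scope ring_scope.

(* Only b(g,h) = - b(h,g) is required: when H has 2-torsion this does not
   force b(g,g) = 0. *)
Definition skew_symmetric (H : zmodType) (G : Type) (b : G -> G -> H) : Prop :=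
  forall g h : G, b g h = - b h g.

Record based_matrix (H : zmodType) := BasedMatrix {
  carrier :> finType;
  base : carrier;
  form : carrier -> carrier -> H;
  form_skew : skew_symmetric form
}.

Arguments base {H} b.
Arguments form {H} b _ _.
Arguments BasedMatrix {H carrier} base {form} form_skew.

Section Elements.
Variables (H : zmodType) (X : based_matrix H).

Definition annihilating (g : X) : Prop :=
  g != base X /\ forall h : X, form X g h = 0.

Definition core (g : X) : Prop :=
  g != base X /\ forall h : X, form X g h = form X (base X) h.

Definition complementary (g1 g2 : X) : Prop :=
  [/\ g1 != base X, g2 != base X &
      forall h : X, form X g1 h + form X g2 h = form X (base X) h].

End Elements.

Section Moves.
Variable H : zmodType.
Implicit Types X Y P Q : based_matrix H.

Definition isomorphic X Y : Prop :=
  exists f : X -> Y,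
    [/\ bijective f, f (base X) = base Y &
        forall x y : X, form Y (f x) (f y) = form X x y].

(* Y lives on the disjoint union of G and {g1, g2}, the set G underlying X
   being identified with its image under the injection i. *)
Definition adjoins X Y (i : X -> Y) (g1 g2 : Y) : Prop :=
  [/\ injective i,
      i (base X) = base Y,
      forall x y : X, form Y (i x) (i y) = form X x y,
      g1 != g2 &
      forall y : Y, (y \in [:: g1; g2]) = (y \notin codom i)].

Definition move1 X Y : Prop :=
  exists (i : X -> Y) (g1 g2 : Y),
    [/\ adjoins i g1 g2, annihilating g1 & annihilating g2].

Definition move2 X Y : Prop :=
  exists (i : X -> Y) (g1 g2 : Y), [/\ adjoins i g1 g2, core g1 & core g2].

Definition move3 X Y : Prop :=
  exists (i : X -> Y) (g1 g2 : Y), adjoins i g1 g2 /\ complementary g1 g2.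

Inductive movew X : based_matrix H -> Prop :=
| Movew (b' : X -> X -> H) (skew' : skew_symmetric b') (g : X) :
    annihilating g ->
    @core H (BasedMatrix (base X) skew') g ->
    (forall x y : X, x != g -> y != g -> b' x y = form X x y) ->
    movew X (BasedMatrix (base X) skew').

Definition move123 X Y : Prop := [\/ move1 X Y, move2 X Y | move3 X Y].

Definition elementary_extension X Y : Prop := move123 X Y \/ movew X Y.

Definition obtained_by_extensions X Y : Prop :=
  clos_refl_trans (based_matrix H) elementary_extension X Y.

Definition homologous X Y : Prop :=
  clos_refl_sym_trans (based_matrix H)
    (fun X Y => elementary_extension X Y \/ isomorphic X Y) X Y.

Definition primitive P : Prop :=
  forall Q, clos_refl_sym_trans (based_matrix H) movew P Q ->
    ~ exists X, move123 X Q.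

End Moves.

(* Main.v *)
From mathcomp Require Import all_boot all_fingroup all_algebra.
Require Import Defs.

(** Call an element special if it is annihilating or core.  An annihilating and
    a core element are complementary, so any two special elements can be removed
    by some [M_i^-1]: the reductions are the removals of a pair which is either
    special or complementary.  Work up to weak isomorphism, i.e. bijections that
    respect the forms except possibly at special elements.  Linear relations
    between rows of non-special elements survive weak isomorphism, because the
    column of a special element is [0] or the column of [s]; hence so do
    removable pairs.  Removals of disjoint pairs commute, while removals of two
    overlapping pairs give weakly isomorphic matrices, by exchanging the two
    elements that are not shared.  So normal forms exist and are unique up to
    weak isomorphism, and an irreducible matrix has at most one special element,
    whose type is all that a weak isomorphism can change. *)

Set Implicit Arguments.
Unset Strict Implicit.
Unset Printing Implicit Defensive.

Import GRing.Theory.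
Local Open Scope ring_scope.

(** * Special elements and removable pairs *)

Section Special.
Variables (H : zmodType) (X : based_matrix H).
Implicit Types (e : bool) (g h x y : X).

(** Coercing [e] to 0 or 1 lets one formula cover annihilating rows ([false]) and core rows
    ([true]). *)
Definition base_multiple (e : bool) g : bool :=
  [forall h, form X g h == form X (base X) h *+ e].

Definition special g : bool :=
  (g != base X) && [exists e, base_multiple e g].

Definition complementary_rows g1 g2 : bool :=
  [forall h, form X g1 h + form X g2 h == form X (base X) h].

Definition removable g1 g2 : bool :=
  [&& g1 != g2, g1 != base X, g2 != base X &
      (special g1 && special g2) || complementary_rows g1 g2].

Lemma base_multipleP e g :
  reflect (forall h, form X g h = form X (base X) h *+ e) (base_multiple e g).
Proof.
by apply: (iffP forallP) => rowg h; [apply/eqP/rowg | apply/eqP].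
Qed.

Lemma complementary_rowsP g1 g2 :
  reflect (forall h, form X g1 h + form X g2 h = form X (base X) h)
          (complementary_rows g1 g2).
Proof.
by apply: (iffP forallP) => rowg h; [apply/eqP/rowg | apply/eqP].
Qed.

Lemma specialP g :
  reflect (g != base X /\ exists e, base_multiple e g) (special g).
Proof.
apply: (iffP andP) => -[gs ge]; split=> //; first exact/existsP.
exact/existsP.
Qed.

Lemma special_base : special (base X) = false.
Proof. by rewrite /special eqxx. Qed.

Lemma base_multiple_column e g h :
  base_multiple e g -> form X h g = form X h (base X) *+ e.
Proof.
by move/base_multipleP => ge; rewrite form_skew ge -mulNrn -form_skew.
Qed.

Lemma annihilatingE g : annihilating g <-> g != base X /\ base_multiple false g.
Proof.
split=> -[gs g0]; split=> //.
  by apply/base_multipleP => h; rewrite g0.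
by move/base_multipleP: g0 => g0 h; rewrite g0.
Qed.

Lemma coreE g : core g <-> g != base X /\ base_multiple true g.
Proof.
split=> -[gs g1]; split=> //.
  by apply/base_multipleP => h; rewrite g1.
by move/base_multipleP: g1 => g1 h; rewrite g1.
Qed.

Lemma annihilating_special g : annihilating g -> special g.
Proof. by case/annihilatingE=> gs g0; apply/specialP; split=> //; exists false. Qed.

Lemma core_special g : core g -> special g.
Proof. by case/coreE=> gs g1; apply/specialP; split=> //; exists true. Qed.

Lemma complementary_rows_sym g1 g2 :
  complementary_rows g1 g2 = complementary_rows g2 g1.
Proof. by apply: eq_forallb => h; rewrite addrC. Qed.

Lemma removable_sym g1 g2 : removable g1 g2 = removable g2 g1.
Proof.
rewrite /removable eq_sym complementary_rows_sym (andbC (special g1)).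
by rewrite [X in _ && X]andbCA.
Qed.

Lemma complementary_special g1 g2 :
  g2 != base X -> complementary_rows g1 g2 -> special g1 -> special g2.
Proof.
move=> g2s /complementary_rowsP gc /specialP[_ [e /base_multipleP ge]].
(* The base row minus [e] times itself is [~~ e] times the base row. *)
apply/specialP; split=> //; exists (~~ e); apply/base_multipleP => h.
have := gc h; rewrite ge; case: e {ge} => /=.
  by rewrite -[RHS]addr0 => /addrI.
by rewrite add0r.
Qed.

(** If [g] is special, so are both its partners; otherwise each partner has as row the base row
    minus the row of [g]. *)
Lemma removable_share g a c :
  removable g a -> removable g c ->
  (special a && special c) || [forall h, form X a h == form X c h].
Proof.
case/and4P=> _ _ aS ga /and4P[_ _ cS gc].
have [sg | nsg] := boolP (special g).
  have sp x : x != base X ->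
      (special g && special x) || complementary_rows g x -> special x.
    by move=> xs /orP[/andP[] // | gx]; apply: complementary_special gx sg.
  by apply/orP; left; rewrite (sp a aS ga) (sp c cS gc).
move: ga gc; rewrite (negbTE nsg) /= => /complementary_rowsP ga.
move/complementary_rowsP=> gc; apply/orP; right; apply/forallP => h.
by apply/eqP/(@addrI _ (form X g h)); rewrite ga gc.
Qed.

End Special.

(** * Weak isomorphisms and submatrices *)

Section WeakIsomorphisms.
Variable H : zmodType.
Implicit Types X Y Z P Q : based_matrix H.

Definition embedding X Y (i : X -> Y) : Prop :=
  [/\ injective i, i (base X) = base Y &
      forall x y, form Y (i x) (i y) = form X x y].

(** An element is exempt only if it and its image are both special. This is symmetric under
    inversion of [f]; that [f] preserves specialness is derived in [weak_iso_special]. *)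
Definition weak_iso X Y (f : X -> Y) : Prop :=
  [/\ bijective f, f (base X) = base Y &
      forall x y, ~~ (special x && special (f x)) ->
        ~~ (special y && special (f y)) -> form Y (f x) (f y) = form X x y].

Definition weakly_isomorphic X Y : Prop := exists f : X -> Y, weak_iso f.

Lemma embedding_comp X Y Z (i : X -> Y) (j : Y -> Z) :
  embedding i -> embedding j -> embedding (j \o i).
Proof.
move=> [ii ib iF] [ji jb jF]; split=> [||x y] /=; first exact: inj_comp.
  by rewrite ib.
by rewrite jF iF.
Qed.

Lemma adjoins_embedding X Y (i : X -> Y) g1 g2 : adjoins i g1 g2 -> embedding i.
Proof. by case. Qed.

Lemma embedding_base X Y (i : X -> Y) x :
  embedding i -> (i x == base Y) = (x == base X).
Proof. by case=> ii <- _; rewrite inj_eq. Qed.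

(** A submatrix only loses columns, so relations between its rows persist. *)
Lemma embedding_base_multiple X Y (i : X -> Y) e x :
  embedding i -> base_multiple e (i x) -> base_multiple e x.
Proof.
move=> [_ ib iF] /base_multipleP xe; apply/base_multipleP => h.
by rewrite -!iF xe ib.
Qed.

Lemma embedding_special X Y (i : X -> Y) x :
  embedding i -> special (i x) -> special x.
Proof.
move=> iE /specialP[]; rewrite (embedding_base _ iE) => xs [e xe].
apply/specialP; split=> //; exists e; exact: embedding_base_multiple xe.
Qed.

Lemma embedding_removable X Y (i : X -> Y) x y :
  embedding i -> removable (i x) (i y) -> removable x y.
Proof.
move=> iE; have [ii ib iF] := iE; rewrite /removable !(embedding_base _ iE).
rewrite (inj_eq ii) => /and4P[-> -> -> /= /orP[/andP[sx sy] | xyc]].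
  by rewrite !(embedding_special iE).
apply/orP; right; apply/complementary_rowsP => h.
by rewrite -!iF (complementary_rowsP _ _ xyc) ib.
Qed.

Lemma weak_iso_base X Y (f : X -> Y) x :
  weak_iso f -> (f x == base Y) = (x == base X).
Proof. by case=> /bij_inj fi <- _; rewrite inj_eq. Qed.

(* The pair [(y0, e)] does not depend on [x]; this transports linear relations
   between rows along [f]. *)
Lemma weak_iso_column X Y (f : X -> Y) (y : Y) :
  weak_iso f ->
  exists (y0 : X) (e : bool), forall x, ~~ (special x && special (f x)) ->
    form Y (f x) y = form X x y0 *+ e.
Proof.
case=> -[f' fK f'K] fb fF; rewrite -(f'K y); move: (f' y) => {}y.
have [/andP[_ /specialP[_ [e ye]]] | ny] := boolP (special y && special (f y)).
  exists (base X), e => x nx; rewrite (base_multiple_column _ ye) -fb fF //.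
  by rewrite special_base.
by exists y, true => x nx; rewrite fF.
Qed.

(** Either [x] is exempt, and [f x] is special outright, or its row relation to the base is carried
    over by [weak_iso_column]. *)
Lemma weak_iso_special_imp X Y (f : X -> Y) x :
  weak_iso f -> special x -> special (f x).
Proof.
move=> fW sx; have [/andP[] // | nx] := boolP (special x && special (f x)).
have [xs [e /base_multipleP xe]] := specialP _ sx.
apply/specialP; split; first by rewrite (weak_iso_base _ fW).
exists e; apply/base_multipleP => y.
have [y0 [n fy]] := weak_iso_column y fW; have [_ <- _] := fW.
by rewrite !fy ?special_base // xe mulrnAC.
Qed.

Lemma weakly_isomorphic_refl X : weakly_isomorphic X X.
Proof. by exists id; split=> //; exists id. Qed.

Lemma weak_iso_inverse X Y (f : X -> Y) (g : Y -> X) :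
  cancel f g -> cancel g f -> weak_iso f -> weak_iso g.
Proof.
move=> fK gK [_ fb fF]; split; [by exists f | by rewrite -fb fK |].
by move=> x y nx ny; rewrite -fF ?gK // andbC.
Qed.

Lemma weakly_isomorphic_sym X Y : weakly_isomorphic X Y -> weakly_isomorphic Y X.
Proof.
case=> f fW; have [[g fK gK] _ _] := fW.
by exists g; apply: weak_iso_inverse fW.
Qed.

Lemma weak_iso_special X Y (f : X -> Y) x :
  weak_iso f -> special (f x) = special x.
Proof.
move=> fW; apply/idP/idP; last exact: weak_iso_special_imp.
have [[g fK gK] _ _] := fW; rewrite -{2}(fK x).
exact/weak_iso_special_imp/(weak_iso_inverse fK).
Qed.

Lemma weak_iso_form X Y (f : X -> Y) x y :
  weak_iso f -> ~~ special x -> ~~ special y ->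
  form Y (f x) (f y) = form X x y.
Proof.
move=> fW nx ny; have [_ _ fF] := fW.
by rewrite fF // !(weak_iso_special _ fW) andbb.
Qed.

Lemma weakly_isomorphic_trans X Y Z :
  weakly_isomorphic X Y -> weakly_isomorphic Y Z -> weakly_isomorphic X Z.
Proof.
move=> [f fW] [g gW]; exists (g \o f); have [fB fb _] := fW.
have [gB gb _] := gW; split=> [||x y] /=; first exact: bij_comp.
  by rewrite fb.
rewrite !(weak_iso_special _ gW) !(weak_iso_special _ fW) !andbb => nx ny.
by rewrite (weak_iso_form gW) ?(weak_iso_form fW) // (weak_iso_special _ fW).
Qed.

Lemma weak_iso_removable X Y (f : X -> Y) g1 g2 :
  weak_iso f -> removable g1 g2 -> removable (f g1) (f g2).
Proof.
move=> fW /and4P[g12 s1 s2 gg]; have [/bij_inj fi fb _] := fW.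
apply/and4P; rewrite !(weak_iso_base _ fW) (inj_eq fi); split=> //.
rewrite !(weak_iso_special _ fW).
have [// | nss] := boolP (special g1 && special g2).
move: gg; rewrite (negbTE nss) /= => gc.
(* In a complementary pair one special member forces the other, so here neither row is exempt. *)
have n1 : ~~ special g1.
  by apply: contra nss => sg1; rewrite sg1 (complementary_special s2 gc).
have n2 : ~~ special g2.
  apply: contra nss => sg2; rewrite sg2 andbT.
  by apply: complementary_special sg2; rewrite // complementary_rows_sym.
apply/complementary_rowsP => y; have [y0 [e fy]] := weak_iso_column y fW.
rewrite -fb !fy ?(negbTE n1) ?(negbTE n2) ?special_base //.
by rewrite -mulrnDl (complementary_rowsP _ _ gc).
Qed.

Lemma weak_iso_restrict X Y X1 Y1 (f : X -> Y) (i : X1 -> X) (j : Y1 -> Y) :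
  weak_iso f -> embedding i -> embedding j ->
  (forall x, (f x \in codom j) = (x \in codom i)) -> weakly_isomorphic X1 Y1.
Proof.
move=> fW iE jE fij; have [[f' fK f'K] fb fF] := fW.
have [ii ib iF] := iE; have [ji jb jF] := jE.
have /fin_all_exists[f1 f1E] (x : X1) : exists y, j y = f (i x).
  by have /codomP[y ->] : f (i x) \in codom j; [rewrite fij codom_f | exists y].
have /fin_all_exists[f2 f2E] (y : Y1) : exists x, i x = f' (j y).
  by have /codomP[x ->] : f' (j y) \in codom i;
    [rewrite -fij f'K codom_f | exists x].
exists f1; split.
- exists f2 => x; first by apply: ii; rewrite f2E f1E fK.
  by apply: ji; rewrite f1E f2E f'K.
- by apply: ji; rewrite f1E ib jb fb.
(* Specialness passes from [X] and [Y] down to the submatrices, so an element not exempt there is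
   not special in [X]. *)
have nsp x : ~~ (special x && special (f1 x)) -> ~~ (special (i x)).
  apply: contra => sx; rewrite (embedding_special iE sx).
  by apply: (embedding_special jE); rewrite f1E (weak_iso_special _ fW).
by move=> x y /nsp nx /nsp ny; rewrite -jF !f1E (weak_iso_form fW) // iF.
Qed.

Lemma isomorphic_weakly X Y : isomorphic X Y -> weakly_isomorphic X Y.
Proof. by case=> f [fB fb fF]; exists f; split. Qed.

(** The identity works: the one element whose pairs change is special before and after the move. *)
Lemma movew_weakly X Y : movew X Y -> weakly_isomorphic X Y.
Proof.
case=> b' skew' g /annihilating_special sg /core_special sg' b'E.
exists id; split=> [||x y]; [by exists id | by [] |].
have ng (z : X) : ~~ (special z && special (z : BasedMatrix (base X) skew')) ->
    z != g.
  by apply: contra => /eqP->; rewrite sg sg'.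
by move=> /ng xg /ng yg; apply: b'E.
Qed.

End WeakIsomorphisms.

(** * Reductions and their local confluence *)

Section Reduction.
Variable H : zmodType.
Implicit Types X Y Z P Q : based_matrix H.

Lemma move123P X Y :
  move123 X Y <->
  exists (i : X -> Y) (g1 g2 : Y), adjoins i g1 g2 /\ removable g1 g2.
Proof.
split.
  case=> -[i [g1 [g2]]].
  - case=> ia a1 a2; exists i, g1, g2; split=> //; case: ia => _ _ _ g12 _.
    rewrite /removable g12 !annihilating_special //.
    by case: a1 a2 => -> _ [-> _].
  - case=> ia c1 c2; exists i, g1, g2; split=> //; case: ia => _ _ _ g12 _.
    by rewrite /removable g12 !core_special //; case: c1 c2 => -> _ [-> _].
  case=> ia [s1 s2 gc]; exists i, g1, g2; split=> //; case: ia => _ _ _ g12 _.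
  rewrite /removable g12 s1 s2; apply/orP; right.
  exact/complementary_rowsP.
case=> i [g1 [g2 [ia /and4P[_ s1 s2 /orP[/andP[] | /complementary_rowsP gc]]]]];
  last by constructor 3; exists i, g1, g2.
(* Two core elements give [move2], two annihilating ones [move1], and the two mixed cases are
   complementary. *)
move=> /specialP[_ [[] e1]] /specialP[_ [[] e2]].
- by constructor 2; exists i, g1, g2; split=> //; apply/coreE.
- constructor 3; exists i, g1, g2; split=> //; split=> // h.
  by rewrite (base_multipleP _ _ e1) (base_multipleP _ _ e2) addr0.
- constructor 3; exists i, g1, g2; split=> //; split=> // h.
  by rewrite (base_multipleP _ _ e1) (base_multipleP _ _ e2) add0r.
by constructor 1; exists i, g1, g2; split=> //; apply/annihilatingE.
Qed.

Lemma adjoins_exists Y (g1 g2 : Y) :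
  g1 != g2 -> g1 != base Y -> g2 != base Y ->
  exists (X : based_matrix H) (i : X -> Y), adjoins i g1 g2.
Proof.
move=> g12 s1 s2.
have sP : base Y \notin [:: g1; g2].
  by rewrite !inE negb_or ![base Y == _]eq_sym s1.
pose T := {y : Y | y \notin [:: g1; g2]}.
have skewT : skew_symmetric (fun x y : T => form Y (val x) (val y)).
  by move=> x y; apply: form_skew.
exists (BasedMatrix (Sub (base Y) sP : T) skewT), val; split=> //.
  exact: val_inj.
move=> y; apply/idP/idP => [yg | ].
  by apply/negP => /codomP[x yx]; have := valP x; rewrite -yx yg.
apply: contraR => yg; apply/codomP; by exists (Sub y yg : T).
Qed.

Lemma removable_move123 Y (g1 g2 : Y) :
  removable g1 g2 ->
  exists (X : based_matrix H) (i : X -> Y), adjoins i g1 g2 /\ move123 X Y.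
Proof.
move=> gr; have /and4P[g12 s1 s2 _] := gr.
have [X [i ia]] := adjoins_exists g12 s1 s2.
by exists X, i; split=> //; apply/move123P; exists i, g1, g2.
Qed.

(** Measure for the inductions below; strict because [i] misses [g1]. *)
Lemma move123_card X Y : move123 X Y -> (#|X| < #|Y|)%N.
Proof.
case/move123P=> i [g1 [g2 [[ii _ _ _ ic] _]]].
rewrite -(card_codom ii) -(cardC [in codom i]) -[X in (X < _)%N]addn0 ltn_add2l.
by apply/card_gt0P; exists g1; rewrite !inE /= -ic !inE eqxx.
Qed.

Lemma weakly_isomorphic_move123 X Y X1 :
  weakly_isomorphic X Y -> move123 X1 X ->
  exists2 Y1, move123 Y1 Y & weakly_isomorphic X1 Y1.
Proof.
move=> [f fW] /move123P[i [g1 [g2 [ia gr]]]].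
have [Y1 [j [ja jm]]] := removable_move123 (weak_iso_removable fW gr).
exists Y1 => //.
apply: (weak_iso_restrict fW (adjoins_embedding ia) (adjoins_embedding ja)).
move=> x; apply: negb_inj; have [_ _ _ _ <-] := ia; have [_ _ _ _ <-] := ja.
by have [/bij_inj fi _ _] := fW; rewrite !inE !(inj_eq fi).
Qed.

(** Exchanging two special elements moves only exempt ones; exchanging two equal rows also exchanges
    equal columns, by skew-symmetry, and preserves the whole form. *)
Lemma tperm_weak_iso X (a c : X) :
  a != base X -> c != base X ->
  (special a && special c) || [forall h, form X a h == form X c h] ->
  weak_iso (tperm a c).
Proof.
move=> aS cS ac; split; first by exists (tperm a c); apply: tpermK.
  by rewrite tpermD.
case/orP: ac => [/andP[sa sc] x y | /forallP ac x y _ _].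
  have nac z : ~~ (special z && special (tperm a c z)) -> tperm a c z = z.
    by case: tpermP => [-> | -> |] //; rewrite sa sc.
  by move=> /nac-> /nac->.
have row u v : form X (tperm a c u) v = form X u v.
  by case: tpermP => [-> | -> |] //; rewrite (eqP (ac v)).
by rewrite row form_skew row -form_skew.
Qed.

(** The transposition of [a] and [c] fixes [g] and carries one deleted pair to the other, so it
    restricts to what remains. *)
Lemma removable_overlap X X1 X2 (i : X1 -> X) (j : X2 -> X) g a c :
  adjoins i g a -> adjoins j g c -> removable g a -> removable g c ->
  weakly_isomorphic X1 X2.
Proof.
move=> ia ja ga gc; have /and4P[nga _ aS _] := ga.
have /and4P[ngc _ cS _] := gc.
have tW := tperm_weak_iso aS cS (removable_share ga gc).
apply: (weak_iso_restrict tW (adjoins_embedding ia) (adjoins_embedding ja)).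
move=> x; apply: negb_inj; have [_ _ _ _ <-] := ia; have [_ _ _ _ <-] := ja.
have tg : tperm a c g = g by rewrite tpermD // eq_sym.
have tx y : (x == y) = (tperm a c x == tperm a c y) by rewrite (inj_eq perm_inj).
by rewrite !inE !tx tg tpermL.
Qed.

Lemma adjoins_sym X Y (i : X -> Y) g1 g2 : adjoins i g1 g2 -> adjoins i g2 g1.
Proof.
case=> ii ib iF g12 ic; split=> //; first by rewrite eq_sym.
by move=> y; rewrite -ic !inE orbC.
Qed.

Lemma move123_confluent X X1 X2 :
  move123 X1 X -> move123 X2 X ->
  weakly_isomorphic X1 X2 \/
  exists Z1 Z2, [/\ move123 Z1 X1, move123 Z2 X2 & weakly_isomorphic Z1 Z2].
Proof.
move=> /move123P[i [g1 [g2 [ia gr]]]] /move123P[j [h1 [h2 [ja hr]]]].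
(* Both pairs are unordered, so it suffices to treat a shared first member of the second pair. *)
have overlap k1 k2 : adjoins j k1 k2 -> removable k1 k2 ->
    k1 \in [:: g1; g2] -> weakly_isomorphic X1 X2.
  rewrite !inE => ka kr /orP[] /eqP k1E; rewrite k1E in ka kr.
    exact: removable_overlap ia ka gr kr.
  by apply: removable_overlap (adjoins_sym ia) ka _ kr; rewrite removable_sym.
have [h1g | h1g] := boolP (h1 \in [:: g1; g2]).
  by left; apply: overlap ja hr h1g.
have [h2g | h2g] := boolP (h2 \in [:: g1; g2]).
  by left; apply: overlap (adjoins_sym ja) _ h2g; rewrite removable_sym.
have [_ _ _ _ ic] := ia; have [_ _ _ _ jc] := ja.
have icE y : (y \in codom i) = (y \notin [:: g1; g2]) by rewrite ic negbK.
have jcE y : (y \in codom j) = (y \notin [:: h1; h2]) by rewrite jc negbK.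
(* Disjoint pairs: [h1], [h2] survive in [X1] as [k1], [k2], and [g1], [g2] in [X2] as [l1],
   [l2]. *)
have /codomP[k1 k1E] : h1 \in codom i by rewrite icE.
have /codomP[k2 k2E] : h2 \in codom i by rewrite icE.
move: h1g h2g; rewrite !inE !negb_or => /andP[h1g1 h1g2] /andP[h2g1 h2g2].
have /codomP[l1 l1E] : g1 \in codom j.
  by rewrite jcE !inE negb_or ![g1 == _]eq_sym h1g1.
have /codomP[l2 l2E] : g2 \in codom j.
  by rewrite jcE !inE negb_or ![g2 == _]eq_sym h1g2.
have iE := adjoins_embedding ia; have jE := adjoins_embedding ja.
have kr : removable k1 k2.
  by apply: (embedding_removable iE); rewrite -k1E -k2E.
have lr : removable l1 l2.
  by apply: (embedding_removable jE); rewrite -l1E -l2E.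
have [Z1 [i' [ia' iM]]] := removable_move123 kr.
have [Z2 [j' [ja' jM]]] := removable_move123 lr.
right; exists Z1, Z2; split=> //.
have codom_comp (A B C : based_matrix H) (u : A -> B) (v : B -> C) m1 m2 z :
    injective v -> adjoins u m1 m2 ->
    (z \in codom (v \o u)) = (z \in codom v) && (z \notin [:: v m1; v m2]).
  move=> vi [_ _ _ _ uc]; apply/codomP/andP => [[x ->] | [/codomP[y ->]]] /=.
    split; first exact: codom_f.
    by rewrite !inE !(inj_eq vi); have:= uc (u x); rewrite !inE codom_f => ->.
  rewrite !inE !(inj_eq vi) => yn.
  have := uc y; rewrite !inE (negbTE yn) => /esym/negbFE/codomP[x ->].
  by exists x.
have [[ii _ _] [ji _ _]] := (iE, jE).
(* Both composite embeddings have as image the complement of the same four elements, so the identity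
   of [X] restricts. *)
apply: (@weak_iso_restrict _ X X _ _ id (i \o i') (j \o j')).
- by split=> //; exists id.
- exact: embedding_comp (adjoins_embedding ia') iE.
- exact: embedding_comp (adjoins_embedding ja') jE.
move=> x; rewrite (codom_comp _ _ _ _ _ _ _ _ ii ia').
rewrite (codom_comp _ _ _ _ _ _ _ _ ji ja').
by rewrite icE jcE -k1E -k2E -l1E -l2E andbC.
Qed.

(** * Existence and uniqueness of normal forms *)

Definition irreducible P : Prop := forall X, ~ move123 X P.

(** This form of the closure splits off the last extension, that is, the first reduction of [X]. *)
Definition normal_form P X : Prop :=
  irreducible P /\ clos_refl_trans_n1 (based_matrix H) (@move123 H) P X.

Lemma reducible_or_irreducible X : (exists X1, move123 X1 X) \/ irreducible X.
Proof.
have [/existsP[g1 /existsP[g2 gr]] | ng] :=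
  boolP [exists g1 : X, exists g2 : X, removable g1 g2].
  by left; have [X1 [i [_ iM]]] := removable_move123 gr; exists X1.
right=> X1 /move123P[i [g1 [g2 [_ gr]]]].
by case/negP: ng; apply/existsP; exists g1; apply/existsP; exists g2.
Qed.

Lemma normal_form_exists X : exists P, normal_form P X.
Proof.
have [n] := ubnP #|X|; elim: n X => // n IHn X ltXn.
have [[X1 XX1] | Xirr] := reducible_or_irreducible X.
  have [P [Pirr PX1]] := IHn X1 (leq_trans (move123_card XX1) ltXn).
  by exists P; split=> //; apply: rtn1_trans XX1 PX1.
by exists X; split=> //; apply: rtn1_refl.
Qed.

Lemma normal_form_move123 P X Y : move123 X Y -> normal_form P X -> normal_form P Y.
Proof. by move=> XY [Pirr PX]; split=> //; apply: rtn1_trans XY PX. Qed.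

Lemma weakly_isomorphic_irreducible X Y :
  weakly_isomorphic X Y -> irreducible X -> irreducible Y.
Proof.
move=> /weakly_isomorphic_sym YX Xirr Y1 Y1Y.
by have [X1 X1X _] := weakly_isomorphic_move123 YX Y1Y; apply: Xirr X1X.
Qed.

Lemma normal_form_inv P X :
  normal_form P X ->
  P = X /\ irreducible X \/ exists2 X1, move123 X1 X & normal_form P X1.
Proof.
case=> Pirr PX; case: PX Pirr => [|X1 {}X X1X PX1] Pirr; first by left.
by right; exists X1.
Qed.

(** Newman's diamond argument modulo weak isomorphism, by induction on the size of [X]. *)
Lemma normal_form_unique X Y P Q :
  weakly_isomorphic X Y -> normal_form P X -> normal_form Q Y ->
  weakly_isomorphic P Q.
Proof.
have [n] := ubnP #|X|; elim: n X Y P Q => // n IHn X Y P Q ltXn XY PX QY.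
case: (normal_form_inv PX) => [[-> Xirr] | [X1 X1X PX1]].
  case: (normal_form_inv QY) => [[-> _] // | [Y1 Y1Y _]].
  by case: (weakly_isomorphic_irreducible XY Xirr Y1Y).
case: (normal_form_inv QY) => [[_ Yirr] | [Y1 Y1Y QY1]].
  by case: (weakly_isomorphic_irreducible (weakly_isomorphic_sym XY) Yirr X1X).
(* The first reduction of [Y] is pulled back, so that both reductions start from [X]. *)
have [X2 X2X Y1X2] := weakly_isomorphic_move123 (weakly_isomorphic_sym XY) Y1Y.
have X2Y1 := weakly_isomorphic_sym Y1X2.
have ltX1 : (#|X1| < n)%N := leq_trans (move123_card X1X) ltXn.
have ltX2 : (#|X2| < n)%N := leq_trans (move123_card X2X) ltXn.
have [X1X2 | [Z1 [Z2 [Z1X1 Z2X2 Z1Z2]]]] := move123_confluent X1X X2X.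
  exact: IHn ltX1 (weakly_isomorphic_trans X1X2 X2Y1) PX1 QY1.
(* [N1] is also a normal form of [X1], and [N2] of [X2]; the induction hypothesis links [P], [N1],
   [N2], [Q] in turn. *)
have [N1 N1Z] := normal_form_exists Z1; have [N2 N2Z] := normal_form_exists Z2.
have PN1 := IHn _ _ _ _ ltX1 (weakly_isomorphic_refl X1) PX1
  (normal_form_move123 Z1X1 N1Z).
have N1N2 := IHn _ _ _ _ (ltn_trans (move123_card Z1X1) ltX1) Z1Z2 N1Z N2Z.
have N2Q := IHn _ _ _ _ ltX2 X2Y1 (normal_form_move123 Z2X2 N2Z) QY1.
exact: weakly_isomorphic_trans PN1 (weakly_isomorphic_trans N1N2 N2Q).
Qed.

(** An extension passes a normal form on to the larger matrix; [movew] and isomorphisms are weak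
    isomorphisms. *)
Lemma homologous_normal_form X Y :
  homologous X Y ->
  forall P Q, normal_form P X -> normal_form Q Y -> weakly_isomorphic P Q.
Proof.
elim=> {X Y} [X Y XY | X | X Y _ IH | X Y Z _ IHXY _ IHYZ] P Q.
- case: XY => [[XY | /movew_weakly XY] | /isomorphic_weakly XY] PX QY.
  + apply: normal_form_unique (weakly_isomorphic_refl Y) _ QY.
    exact: normal_form_move123 PX.
  + exact: normal_form_unique XY PX QY.
  exact: normal_form_unique XY PX QY.
- exact: normal_form_unique (weakly_isomorphic_refl X).
- by move=> PY QX; apply: weakly_isomorphic_sym; apply: IH.
move=> PX QZ; have [N NY] := normal_form_exists Y.
exact: weakly_isomorphic_trans (IHXY _ _ PX NY) (IHYZ _ _ NY QZ).
Qed.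

(** * Primitive matrices and the single [movew] *)

Lemma movew_closure_weakly P Q :
  clos_refl_sym_trans (based_matrix H) (@movew H) P Q -> weakly_isomorphic P Q.
Proof.
elim=> {P Q} [P Q | P | P Q _ | P Q R _ PQ _].
- exact: movew_weakly.
- exact: weakly_isomorphic_refl.
- exact: weakly_isomorphic_sym.
exact: weakly_isomorphic_trans PQ.
Qed.

(** Irreducibility is invariant under weak isomorphism, hence under [movew] and its inverse. *)
Lemma primitiveE P : primitive P <-> irreducible P.
Proof.
split=> [Pprim X XP | Pirr Q /movew_closure_weakly PQ [X XQ]].
  by apply: (Pprim P); [apply: rst_refl | exists X].
exact: weakly_isomorphic_irreducible PQ Pirr _ XQ.
Qed.

Lemma irreducible_special X (x y : X) :
  irreducible X -> special x -> special y -> x = y.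
Proof.
move=> Xirr sx sy; apply/eqP; apply: contraT => xy.
have [] : exists X1, move123 X1 X; last by move=> X1 /Xirr.
have [xs _] := specialP _ sx; have [ys _] := specialP _ sy.
have xyr : removable x y by rewrite /removable xy xs ys sx sy.
by have [X1 [i [_ iM]]] := removable_move123 xyr; exists X1.
Qed.

(** A common [e] expresses the rows and columns of a special element and its image through those of
    the bases, where [f] preserves the form. *)
Lemma weak_iso_isomorphic X Y (f : X -> Y) :
  weak_iso f ->
  (forall x, special x -> exists e, base_multiple e x && base_multiple e (f x)) ->
  isomorphic X Y.
Proof.
move=> fW fe; have [fB fb _] := fW; exists f; split=> //.
have nonsp x y : ~~ special x -> form Y (f x) (f y) = form X x y.
  move=> nx; have [/fe[e /andP[ye fye]] | ny] := boolP (special y).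
    rewrite (base_multiple_column _ ye) (base_multiple_column _ fye) -fb.
    by rewrite (weak_iso_form fW) // special_base.
  exact: weak_iso_form.
move=> x y; have [/fe[e /andP[xe fxe]] | nx] := boolP (special x).
  rewrite (base_multipleP _ _ xe) (base_multipleP _ _ fxe) -fb nonsp //.
  by rewrite special_base.
exact: nonsp.
Qed.

Lemma weak_iso_movew X Y (f : X -> Y) (z : X) :
  weak_iso f -> irreducible X -> z != base X ->
  base_multiple false z -> base_multiple true (f z) ->
  exists R : based_matrix H, movew X R /\ isomorphic Y R.
Proof.
move=> fW Xirr zs z0 fz1; have [[g fK gK] fb _] := fW.
(* [R] is the form of [Y] pulled back to the carrier of [X]; it can differ from [X] only at [z], the
   sole special element. *)
have skew' : skew_symmetric (fun x y => form Y (f x) (f y)).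
  by move=> x y; apply: form_skew.
have az : annihilating z by apply/annihilatingE.
exists (BasedMatrix (base X) skew'); split.
  apply: (@Movew _ X _ skew' z az).
    by split=> // h /=; rewrite (base_multipleP _ _ fz1) fb.
  have nsp x : x != z -> ~~ special x.
    apply: contra => sx; apply/eqP.
    exact: irreducible_special Xirr sx (annihilating_special az).
  by move=> x y /nsp nx /nsp ny; apply: weak_iso_form.
exists g; split=> [||x y] /=; first by exists f.
  by rewrite -fb fK.
by rewrite !gK.
Qed.

Lemma irreducible_weakly_isomorphic P Q :
  irreducible P -> irreducible Q -> weakly_isomorphic P Q ->
  isomorphic P Q \/
  (exists R : based_matrix H, movew P R /\ isomorphic Q R) \/
  (exists R : based_matrix H, movew Q R /\ isomorphic P R).
Proof.
move=> Pirr Qirr [f fW].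
case: (pickP (@special H P)) => [z sz | nsp]; last first.
  by left; apply: (weak_iso_isomorphic fW) => x; rewrite nsp.
have sfz : special (f z) by rewrite (weak_iso_special _ fW).
have [zs [e ze]] := specialP _ sz; have [fzs [e' fze]] := specialP _ sfz.
have [ee | ee] := eqVneq e e'.
  left; apply: (weak_iso_isomorphic fW) => x sx; exists e.
  by rewrite (irreducible_special Pirr sx sz) ze ee.
(* If [z] is annihilating and [f z] core, the move applies to [P]; in the opposite case it applies
   to [Q], along the inverse of [f]. *)
case: e e' ee ze fze => [] [] // _ ze fze; right; last first.
  by left; apply: weak_iso_movew ze fze.
right; have [[g fK gK] _ _] := fW.
by apply: (weak_iso_movew (weak_iso_inverse fK gK fW) Qirr fzs fze); rewrite fK.
Qed.

End Reduction.

Theorem lemma21 (H : zmodType) :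
  (forall X : based_matrix H,
     exists P : based_matrix H, primitive P /\ obtained_by_extensions P X) /\
  (forall P Q : based_matrix H,
     primitive P -> primitive Q -> homologous P Q ->
     isomorphic P Q \/
     (exists R : based_matrix H, movew P R /\ isomorphic Q R) \/
     (exists R : based_matrix H, movew Q R /\ isomorphic P R)).
Proof.
split=> [X | P Q /primitiveE Pirr /primitiveE Qirr PQ].
  have [P [Pirr PX]] := normal_form_exists X.
  exists P; split; first exact/primitiveE.
  elim: PX => [|Y Z YZ _ PY]; first exact: rt_refl.
  by apply: rt_trans PY _; apply: rt_step; left.
apply: irreducible_weakly_isomorphic => //.
(* An irreducible matrix is its own normal form. *)
by apply: (homologous_normal_form PQ); split=> //; apply: rtn1_refl.
Qed.
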